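(* Let $X$ be a property of sets of vertices of a graph satisfying conditions (1)–(4) of the context. Suppose $G$ and $H$ are graphs with no isolated vertices and $\mathcal{X}^{TAR}(G)\cong \mathcal{X}^{TAR}(H)$. Then (1) $|V(G)|=|V(H)|$; (2) $X(G)=X(H)$; (3) $\overline{X}(G)=\overline{X}(H)$.
   Context: Graphs are finite and simple with non-empty vertex set. Let $X$ be a property of sets of vertices of a graph; a set of vertices of $G$ having the property is called an $X$-set of $G$. The conditions on $X$ are: (1) if $S$ is an $X$-set and $S\subset S'$, then $S'$ is an $X$-set; (2) $\emptyset$ is not an $X$-set; (3) the $X$-sets of a disconnected graph are the unions of an $X$-set of each component; (4) for a graph $G$ of order $n$ with no isolated vertices, every set of $n-1$ vertices is an $X$-set. The parameter $X(G)$ is the minimum cardinality of an $X$-set of $G$. A minimal $X$-set is an $X$-set such that removing any vertex from it gives a set that is not an $X$-set, and $\overline{X}(G)$ is the maximum cardinality of a minimal $X$-set of $G$. The token addition and removal (TAR) reconfiguration graph $\mathcal{X}^{TAR}(G)$ has as vertices all $X$-sets of $G$, with two $X$-sets $S_1,S_2$ adjacent if and only if one is obtained from the other by adding or removing a single vertex, i.e. $|S_1\ominus S_2|=1$, where $\ominus$ denotes symmetric difference. *)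

(* Defs.v *)
From mathcomp Require Import all_boot.

Set Implicit Arguments.
Unset Strict Implicit.
Unset Printing Implicit Defensive.

(* Finite simple graphs.  The vertex type may be empty; non-emptiness is
   required separately, as [0 < #|G|], wherever an input graph is quantified. *)
Record sgraph := SGraph {
  svertex :> finType;
  sedge : rel svertex;
  sedge_sym : symmetric sedge;
  sedge_irrefl : irreflexive sedge }.

Definition graph_iso (G H : sgraph) : Prop :=
  exists2 f : G -> H, bijective f & forall x y, sedge (f x) (f y) = sedge x y.

Definition no_isolated (G : sgraph) : Prop :=
  forall x : G, exists y : G, sedge x y.

Section Induced.
Variables (G : sgraph) (A : {set G}).

Definition induced_rel : rel {x : G | x \in A} :=
  fun x y => sedge (val x) (val y).

Lemma induced_sym : symmetric induced_rel.
Proof. by move=> x y; apply: sedge_sym. Qed.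

Lemma induced_irrefl : irreflexive induced_rel.
Proof. by move=> x; apply: sedge_irrefl. Qed.

Definition induced : sgraph := SGraph induced_sym induced_irrefl.
End Induced.

Definition components (G : sgraph) : {set {set G}} :=
  [set [set y | connect (@sedge G) x y] | x : G].

Definition disconnected (G : sgraph) : Prop :=
  exists x y : G, ~~ connect (@sedge G) x y.

Definition set_property := forall G : sgraph, pred {set G}.

Record Xset_conditions (X : set_property) : Prop := XsetConditions {
  Xset_superset : forall G : sgraph, 0 < #|G| ->
    forall S S' : {set G}, X G S -> S \subset S' -> X G S';
  Xset_set0 : forall G : sgraph, 0 < #|G| -> ~~ X G set0;
  Xset_components : forall G : sgraph, disconnected G ->
    forall S : {set G},
      X G S <->
      exists T : forall C : {set G}, {set induced C},
        (forall C, C \in components G -> X (induced C) (T C)) /\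
        S = \bigcup_(C in components G) [set val x | x in T C];
  Xset_card_pred : forall G : sgraph, 0 < #|G| -> no_isolated G ->
    forall S : {set G}, #|S| = #|G| - 1 -> X G S }.

(* The default #|G| of the minimum is an upper bound of all the cardinalities,
   so it only matters when G has no X-set at all. *)
Definition Xnum (X : set_property) (G : sgraph) : nat :=
  \big[minn/#|G|]_(S : {set G} | X G S) #|S|.

Definition minimal_Xset (X : set_property) (G : sgraph) (S : {set G}) : bool :=
  X G S && [forall x in S, ~~ X G (S :\ x)].

Definition upper_Xnum (X : set_property) (G : sgraph) : nat :=
  \max_(S : {set G} | minimal_Xset X S) #|S|.

Definition symdiff (T : finType) (A B : {set T}) : {set T} :=
  (A :\: B) :|: (B :\: A).

Section TAR.
Variables (X : set_property) (G : sgraph).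

Definition TAR_rel : rel {S : {set G} | X S} :=
  fun S1 S2 => #|symdiff (val S1) (val S2)| == 1.

Lemma TAR_sym : symmetric TAR_rel.
Proof. by move=> S1 S2; rewrite /TAR_rel /symdiff setUC. Qed.

Lemma TAR_irrefl : irreflexive TAR_rel.
Proof. by move=> S; rewrite /TAR_rel /symdiff setDv setU0 cards0. Qed.

Definition TAR : sgraph := SGraph TAR_sym TAR_irrefl.
End TAR.

(* Main.v *)
Require Import Defs.
From HB Require Import structures.
From mathcomp Require Import all_boot.

Set Implicit Arguments.
Unset Strict Implicit.
Unset Printing Implicit Defensive.

(** The X-sets of [G] form an up-closed family of subsets of [V(G)], and the TAR
    graph is the subgraph of the hypercube [2^V(G)] that it induces.

    Such a subgraph is isometric: from [A] one reaches [B] in [#|symdiff A B|]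
    steps by first adding the elements of [B \ A] and then removing those of
    [A \ B], which stays inside the family.  So an isomorphism [p] preserves the
    Hamming distance ([cube_iso_isometry]).

    The full vertex set is an X-set, and so is every co-singleton, because there
    are no isolated vertices.  Hence [p] maps the
    co-singletons to neighbours of [p setT], each of which differs from [p setT]
    by one vertex; this gives an injection [f : V(G) -> V(H)] ([dirE],
    [dir_inj]), and the inverse isomorphism gives an injection backwards, so the
    orders agree and [f] is a bijection.  A set is determined by its distances
    to the empty set and to the singletons, so [p] is forced to be
    [S |-> symdiff (f @: S) R], where [R] is the complement of [p setT]
    ([preim_dir_iso]).

    Now identify [V(G)] with [V(H)] along [f].  The two families of X-sets are
    both up-closed and are translates of each other by [R].  Translation by [R]
    turns adding [R] into removing [R], so both families are closed under
    removing [R], and therefore they are equal ([upset_translate_eq]).  Thus [f]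
    itself carries the X-sets of [G] onto those of [H], and every parameter that
    is defined from the family alone agrees. *)

(** * Hamming distance on subsets *)

Section Symdiff.
Variable T : finType.
Implicit Types A B C R : {set T}.

Lemma in_symdiff A B x : (x \in symdiff A B) = (x \in A) (+) (x \in B).
Proof. by rewrite !inE; do 2!case: (x \in _). Qed.

Lemma symdiffK A R : symdiff (symdiff A R) R = A.
Proof. by apply/setP=> x; rewrite !in_symdiff addbK. Qed.

Lemma symdiff_inj R : injective (fun A => symdiff A R).
Proof. exact: inv_inj (fun A => symdiffK A R). Qed.

Lemma symdiff_translate A B R : symdiff (symdiff A R) (symdiff B R) = symdiff A B.
Proof. by apply/setP=> x; rewrite !in_symdiff addbACA addbb addbF. Qed.

Lemma symdiff_setC A B : symdiff (~: A) (~: B) = symdiff A B.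
Proof.
by apply/setP=> x; rewrite !in_symdiff !in_setC; do 2!case: (x \in _).
Qed.

Lemma symdiff_eq0 A B : (symdiff A B == set0) = (A == B).
Proof. by rewrite setU_eq0 !setD_eq0 eqEsubset. Qed.

Lemma card_symdiff_triangle A B C :
  #|symdiff A C| <= #|symdiff A B| + #|symdiff B C|.
Proof.
apply: leq_trans (leq_card_setU _ _); apply: subset_leq_card.
apply/subsetP=> x; rewrite in_setU !in_symdiff.
by do 3!case: (x \in _).
Qed.

Lemma symdiff1 A x : symdiff A (symdiff A [set x]) = [set x].
Proof. by apply/setP=> y; rewrite !in_symdiff addKb. Qed.

Lemma mem_card_symdiff1 A x : (x \in A) = (#|symdiff A [set x]| < #|A|).
Proof.
case: (boolP (x \in A)) => xA.
- have -> : symdiff A [set x] = A :\ x.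
    apply/setP=> y; rewrite in_symdiff !inE.
    by case: eqP => [->|_]; rewrite ?xA ?addbF.
  by rewrite [X in _ < X](cardsD1 x A) xA ltnS leqnn.
- have -> : symdiff A [set x] = x |: A.
    apply/setP=> y; rewrite in_symdiff !inE.
    by case: eqP => [->|_]; rewrite ?(negbTE xA) ?addbF.
  by rewrite cardsU1 xA ltnNge leq_addl.
Qed.

End Symdiff.

(** * Up-closed families as induced subgraphs of the hypercube *)

Definition upset (T : finType) (U : pred {set T}) : Prop :=
  forall A B : {set T}, U A -> A \subset B -> U B.

Definition cube_hom (T T' : finType) (U : pred {set T}) (W : pred {set T'})
    (p : {set T} -> {set T'}) : Prop :=
  (forall A, U A -> W (p A)) /\
  (forall A B, U A -> U B -> #|symdiff A B| = 1 -> #|symdiff (p A) (p B)| = 1).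

(** An element of [B \ A] is added as long as there is one; afterwards [B] is
    contained in [A], and whatever is removed from [A \ B] leaves a superset
    of [B]. *)
Lemma upset_step (T : finType) (U : pred {set T}) (A B : {set T}) :
    upset U -> U A -> U B -> A != B ->
  exists2 A', U A' & #|symdiff A A'| = 1 /\ #|symdiff A B| = #|symdiff A' B|.+1.
Proof.
move=> upU UA UB; rewrite -symdiff_eq0.
have step x : x \in symdiff A B ->
    #|symdiff A (symdiff A [set x])| = 1 /\
    #|symdiff A B| = #|symdiff (symdiff A [set x]) B|.+1.
  move=> xAB; rewrite symdiff1 cards1; split=> //.
  rewrite (cardsD1 x) xAB add1n; congr (_.+1); apply: eq_card => y.
  rewrite in_setD1 !in_symdiff in_set1.
  case: (altP (y =P x)) => [->|_]; last by rewrite addbF.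
  by move: xAB; rewrite in_symdiff; do 2!case: (x \in _).
have [sBA|] := boolP (B \subset A).
  case/set0Pn=> x xAB; exists (symdiff A [set x]); last exact: step.
  apply: upU UB _; apply/subsetP=> y yB; rewrite in_symdiff (subsetP sBA y yB).
  rewrite in_set1; apply: contraTneq yB => ->.
  by move: xAB; rewrite in_symdiff; case: (boolP (x \in B)) => // /(subsetP sBA) ->.
case/subsetPn=> x xB xA _; exists (symdiff A [set x]).
  apply: upU UA _; apply/subsetP=> y yA; rewrite in_symdiff yA in_set1.
  by apply: contraTneq yA => ->.
by apply: step; rewrite in_symdiff xB (negbTE xA).
Qed.

Lemma cube_hom_contract (T T' : finType) (U : pred {set T}) (W : pred {set T'})
    (p : {set T} -> {set T'}) (A B : {set T}) :
    upset U -> cube_hom U W p -> U A -> U B ->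
  #|symdiff (p A) (p B)| <= #|symdiff A B|.
Proof.
move=> upU [_ pE] UA UB; have [n] := ubnP #|symdiff A B|.
elim: n A UA => // n IHn A UA; have [->|neqAB] := eqVneq A B.
  by rewrite /symdiff !setDv !setU0 !cards0.
have [A' UA' [dAA' dAB]] := upset_step upU UA UB neqAB.
rewrite dAB !ltnS => ltn.
apply: leq_trans (card_symdiff_triangle _ (p A') _) _.
by rewrite (pE _ _ UA UA' dAA') add1n ltnS IHn.
Qed.

(** Translating by [R] exchanges adding [R] and removing [R]: if [A] is in [U]
    then [symdiff A R :|: R = A :|: R] is in [W], and it is the translate of
    [A :\: R], which is therefore in [U].  So membership in either family does
    not depend on [R], whence the translation does nothing. *)
Lemma upset_translate_sub (T : finType) (U W : pred {set T}) (R : {set T}) :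
    upset U -> upset W -> (forall S, U S = W (symdiff S R)) ->
  forall S, U S -> W S.
Proof.
move=> upU upW UW.
have WU S : W S = U (symdiff S R) by rewrite UW symdiffK.
have DR S : symdiff (S :\: R) R = S :|: R.
  by apply/setP=> x; rewrite in_symdiff !inE; do 2!case: (x \in _).
have UR S : symdiff S R \subset S :|: R.
  by apply/subsetP=> x; rewrite in_symdiff !inE; do 2!case: (x \in _).
have remR (U1 W1 : pred {set T}) :
    upset W1 -> (forall S, U1 S = W1 (symdiff S R)) ->
    forall S, U1 S -> U1 (S :\: R).
  move=> upW1 UW1 S; rewrite !UW1 DR => WS; exact: upW1 WS (UR S).
move=> S US; apply: (upW (S :\: R)); last exact: subsetDl.
have -> : S :\: R = (S :|: R) :\: R by rewrite setDUl setDv setU0.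
apply: (remR _ _ upU WU).
by rewrite -DR -UW; exact: (remR _ _ upW UW).
Qed.

Lemma upset_translate_eq (T : finType) (U W : pred {set T}) (R : {set T}) :
    upset U -> upset W -> (forall S, U S = W (symdiff S R)) -> U =1 W.
Proof.
move=> upU upW UW S; apply/idP/idP.
  exact: upset_translate_sub upU upW UW S.
by apply: (upset_translate_sub upW upU (R := R)) => A; rewrite UW symdiffK.
Qed.

(** * Isomorphisms between induced subgraphs of hypercubes *)

Section CubeIso.
Variables (T T' : finType) (U : pred {set T}) (W : pred {set T'}).
Variables (p : {set T} -> {set T'}) (q : {set T'} -> {set T}).
Hypotheses (upU : upset U) (upW : upset W).
Hypotheses (UT : U setT) (UC1 : forall x, U [set~ x]).
Hypotheses (pH : cube_hom U W p) (qH : cube_hom W U q).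
Hypotheses (pK : forall A, U A -> q (p A) = A).

Lemma cube_iso_isometry A B :
  U A -> U B -> #|symdiff (p A) (p B)| = #|symdiff A B|.
Proof.
move=> UA UB; apply/eqP; rewrite eqn_leq (cube_hom_contract upU pH) //=.
have [pW _] := pH.
by have := cube_hom_contract upW qH (pW _ UA) (pW _ UB); rewrite !pK.
Qed.

Lemma dir_subproof x : exists y, symdiff (p [set~ x]) (p setT) == [set y].
Proof.
suff /cards1P[y ->] : #|symdiff (p [set~ x]) (p setT)| == 1 by exists y.
rewrite cube_iso_isometry // -setC0 symdiff_setC.
by rewrite /symdiff setD0 set0D setU0 cards1.
Qed.

(** The coordinate in which [p] moves along the image of the edge of the
    hypercube from [setT] to [[set~ x]]. *)
Definition dir x : T' := xchoose (dir_subproof x).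

Lemma dirE x : symdiff (p [set~ x]) (p setT) = [set dir x].
Proof. exact/eqP/(xchooseP (dir_subproof x)). Qed.

Lemma dir_inj : injective dir.
Proof.
move=> x y exy; have := dirE x; rewrite exy -dirE => /symdiff_inj.
by move/(congr1 q); rewrite !pK // => /setC_inj/set1_inj.
Qed.

(** Seen from [p setT], the sets [p S] and [p [set~ x]] become
    [symdiff (p S) (p setT)] and [[set dir x]], and the distances between them
    are those between [~: S] and [[set x]]; these distances decide membership. *)
Lemma preim_dir_iso S : U S ->
  dir @^-1: p S = symdiff S (dir @^-1: ~: p setT).
Proof.
move=> US; apply/setP=> x; rewrite in_symdiff !inE.
have: (dir x \in symdiff (p S) (p setT)) = (x \in ~: S).
  rewrite !mem_card_symdiff1 -dirE symdiff_translate !cube_iso_isometry //.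
  rewrite -(symdiff_setC S) -(symdiff_setC S setT) setCT setCK.
  by rewrite [symdiff _ set0]/symdiff setD0 set0D setU0.
rewrite in_symdiff in_setC.
by case: (x \in S); case: (dir x \in p S); case: (dir x \in p setT).
Qed.

Hypothesis qK : forall B, W B -> p (q B) = B.

Lemma dir_imset_iso : bijective dir -> forall S, U S = W (dir @: S).
Proof.
move=> bij_f S.
pose W' := [pred A : {set T} | W (dir @: A)].
have upW' : upset W' by move=> A B WA sAB; apply: upW WA (imsetS _ sAB).
have fK (A : {set T'}) : dir @: (dir @^-1: A) = A.
  have [g _ gK] := bij_f; apply/setP=> y; rewrite -[y]gK mem_imset ?inE //.
  exact: dir_inj.
have fKV (A : {set T}) : dir @^-1: (dir @: A) = A.
  by apply/setP=> x; rewrite inE mem_imset //; exact: dir_inj.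
apply: (upset_translate_eq (R := dir @^-1: ~: p setT) upU upW') => A /=.
have [pW _] := pH; have [qU _] := qH; apply/idP/idP=> [UA|WA].
  by rewrite -preim_dir_iso // fK pW.
suff <- : q (dir @: symdiff A (dir @^-1: ~: p setT)) = A by exact: qU.
apply: (@symdiff_inj _ (dir @^-1: ~: p setT)).
by rewrite -preim_dir_iso ?qU // qK // fKV.
Qed.

End CubeIso.

(** Applying the construction of [dir] in both directions yields injections both
    ways, so either of them is bijective. *)
Lemma cube_iso_relabel (T T' : finType) (U : pred {set T}) (W : pred {set T'})
    (p : {set T} -> {set T'}) (q : {set T'} -> {set T}) :
    upset U -> upset W -> U setT -> W setT ->
    (forall x, U [set~ x]) -> (forall y, W [set~ y]) ->
    cube_hom U W p -> cube_hom W U q ->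
    (forall A, U A -> q (p A) = A) -> (forall B, W B -> p (q B) = B) ->
  exists2 f : T -> T', bijective f & forall S, U S = W (f @: S).
Proof.
move=> upU upW UT WT UC1 WC1 pH qH pK qK.
pose f := dir upU upW UT UC1 pH qH pK.
have bij_f : bijective f.
  apply: inj_card_bij; first exact: dir_inj.
  by apply: (leq_card (dir upW upU WT WC1 qH pH qK)); exact: dir_inj.
by exists f => //; exact: dir_imset_iso.
Qed.

(** * Parameters of a graph and its X-sets *)

(** Makes minima over bijectively related index sets comparable by
    [reindex]. *)
HB.instance Definition _ := SemiGroup.isComLaw.Build nat minn minnA minnC.

Section Relabel.
Variables (X : set_property) (G H : sgraph) (f : G -> H).
Hypotheses (bij_f : bijective f) (fX : forall S, X S = X (f @: S)).

Let inj_f : injective f := bij_inj bij_f.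

Lemma imset_bij : bijective (fun S : {set G} => f @: S).
Proof.
have [g fK gK] := bij_f; exists (fun S : {set H} => g @: S) => S;
  rewrite -imset_comp -[RHS]imset_id; exact: eq_imset.
Qed.

Lemma Xnum_relabel : Xnum X G = Xnum X H.
Proof.
rewrite /Xnum -(bij_eq_card bij_f).
rewrite [RHS](reindex _ (onW_bij _ imset_bij)) /=.
by apply: eq_big => S; rewrite -?fX // card_imset.
Qed.

Lemma minimal_Xset_relabel (S : {set G}) :
  minimal_Xset X (f @: S) = minimal_Xset X S.
Proof.
rewrite /minimal_Xset -fX; congr (_ && _).
have fD x : f @: (S :\ x) = (f @: S) :\ f x.
  have [g _ gK] := bij_f; apply/setP=> y; rewrite -[y]gK.
  by rewrite !(mem_imset, inE) // (inj_eq inj_f).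
apply/forall_inP/forall_inP=> mS x xS.
  by rewrite fX fD mS ?imset_f.
by have /imsetP[y yS ->] := xS; rewrite -fD -fX mS.
Qed.

Lemma upper_Xnum_relabel : upper_Xnum X G = upper_Xnum X H.
Proof.
rewrite /upper_Xnum [RHS](reindex _ (onW_bij _ imset_bij)) /=.
by apply: eq_big => S; rewrite ?minimal_Xset_relabel // card_imset.
Qed.

End Relabel.

Section TARFacts.
Variables (X : set_property) (hX : Xset_conditions X).
Variables (G : sgraph) (hG0 : 0 < #|G|) (hG : no_isolated G).

Lemma Xset_upset : upset (@X G).
Proof. by move=> A B; apply: Xset_superset. Qed.

Lemma Xset_setC1 (x : G) : X [set~ x].
Proof. by apply: Xset_card_pred; rewrite // cardsC1 subn1. Qed.

Lemma Xset_setT : X [set: G].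
Proof.
by have /card_gt0P[x _] := hG0; apply: Xset_upset (Xset_setC1 x) (subsetT _).
Qed.

(** A map out of the TAR graph, extended to all vertex sets; the value outside
    the X-sets is immaterial. *)
Definition TAR_ext (H : sgraph) (f : TAR X G -> TAR X H) (S : {set G}) : {set H} :=
  val (f (insubd (Sub [set: G] Xset_setT) S)).

Lemma TAR_ext_hom (H : sgraph) (f : TAR X G -> TAR X H) :
    {mono f : S1 S2 / sedge S1 S2} -> cube_hom (@X G) (@X H) (TAR_ext f).
Proof.
move=> fE; split=> [A _|A B XA XB dAB]; first exact: valP.
apply/eqP; rewrite /TAR_ext.
set a := insubd _ A; set b := insubd _ B.
have := fE a b; rewrite /= /TAR_rel => ->.
by rewrite /a /b !insubdK // dAB.
Qed.

End TARFacts.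

Lemma TAR_extK (X : set_property) (hX : Xset_conditions X) (G H : sgraph)
    (hG0 : 0 < #|G|) (hG : no_isolated G) (hH0 : 0 < #|H|) (hH : no_isolated H)
    (f : TAR X G -> TAR X H) (g : TAR X H -> TAR X G) :
  cancel f g ->
  forall A, X G A -> TAR_ext hX hH0 hH g (TAR_ext hX hG0 hG f A) = A.
Proof. by move=> fK A XA; rewrite /TAR_ext valKd fK insubdK. Qed.

Theorem corollary2p16 (X : set_property) (hX : Xset_conditions X)
    (G H : sgraph) (hG0 : 0 < #|G|) (hH0 : 0 < #|H|)
    (hG : no_isolated G) (hH : no_isolated H)
    (hTAR : graph_iso (TAR X G) (TAR X H)) :
  [/\ #|G| = #|H|,
      Xnum X G = Xnum X H
    & upper_Xnum X G = upper_Xnum X H].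
Proof.
have [phi [psi phiK psiK] phiE] := hTAR.
have psiE : {mono psi : S1 S2 / sedge S1 S2}.
  by move=> S1 S2; rewrite -phiE !psiK.
have [f bij_f fX] :
    exists2 f : G -> H, bijective f & forall S : {set G}, X G S = X H (f @: S).
  apply: (cube_iso_relabel (Xset_upset hX hG0) (Xset_upset hX hH0)
            (Xset_setT hX hG0 hG) (Xset_setT hX hH0 hH)
            (Xset_setC1 hX hG0 hG) (Xset_setC1 hX hH0 hH)
            (TAR_ext_hom hX hG0 hG phiE) (TAR_ext_hom hX hH0 hH psiE)).
  - exact: TAR_extK phiK.
  - exact: TAR_extK psiK.
split; first exact: bij_eq_card bij_f.
- exact: Xnum_relabel bij_f fX.
- exact: upper_Xnum_relabel bij_f fX.
Qed.
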